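(* Let $n\in\mathbb N$ and let $\varphi:\mathbb R\to\mathbb R$ be continuous such that $\lim_{x\to-\infty}\varphi(x)$ and $\lim_{x\to\infty}\varphi(x)$ exist and are finite. Then the vector space $\overline{\mathcal N_\varphi^\infty(\mathbb R^n)}$ is an algebra under the pointwise product, i.e. it is closed under pointwise multiplication. Equivalently, for all $f,g\in\mathcal N_\varphi^\infty(\mathbb R^n)$ the pointwise product $fg$ lies in $\overline{\mathcal N_\varphi^\infty(\mathbb R^n)}$.
   Context: $\mathbb N=\{1,2,\ldots\}$. For a function $\varphi:\mathbb R\to\mathbb R$ define the real vector spaces of functions $\mathbb R^n\to\mathbb R$ $$\mathcal N_\varphi^1(\mathbb R^n):=\operatorname{span}\{x\mapsto\varphi(a\cdot x+b)\mid a\in\mathbb R^n,\ b\in\mathbb R\},$$ recursively for $l\ge2$, $$\mathcal N_\varphi^l(\mathbb R^n):=\operatorname{span}\{x\mapsto\varphi(f(x)+b)\mid f\in\mathcal N_\varphi^{l-1}(\mathbb R^n),\ b\in\mathbb R\},$$ and $\mathcal N_\varphi^\infty(\mathbb R^n):=\bigcup_{l\ge1}\mathcal N_\varphi^l(\mathbb R^n)$; here span is the $\mathbb R$-linear span and $a\cdot x$ is the Euclidean inner product. For a set $S$ of functions $\mathbb R^n\to\mathbb R$, $\overline S$ is its uniform closure (closure with respect to the supremum norm over $\mathbb R^n$). The algebra is not required to be unital. *)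

(* Defs.v *)
From mathcomp Require Import all_boot all_order all_algebra.
From mathcomp Require Import all_classical all_reals all_analysis.

Import Order.TTheory GRing.Theory Num.Theory.
Import numFieldNormedType.Exports.

Local Open Scope classical_set_scope.
Local Open Scope ring_scope.

Definition dot {R : realType} {n : nat} (a x : 'rV[R]_n) : R :=
  \sum_(i < n) a 0 i * x 0 i.

Definition fun_span {R : realType} {T : Type} (S : set (T -> R)) :
    set (T -> R) :=
  [set f | exists (m : nat) (c : 'I_m -> R) (g : 'I_m -> T -> R),
     (forall i, S (g i)) /\ f = (fun x => \sum_(i < m) c i * g i x)].

(* For l >= 1, [network phi n l] is N_phi^l(R^n). Level 0 is not one of these
   spaces: it is the set of linear forms x |-> a . x, so that the recursive
   clause at l = 0 gives the span of the functions x |-> phi (a . x + b). *)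
Fixpoint network {R : realType} (phi : R -> R) (n l : nat) :
    set ('rV[R]_n -> R) :=
  match l with
  | 0 => [set dot a | a in [set: 'rV[R]_n]]
  | l'.+1 => fun_span [set h | exists (f : 'rV[R]_n -> R) (b : R),
                         network phi n l' f /\ h = (fun x => phi (f x + b))]
  end.

Definition network_infty {R : realType} (phi : R -> R) (n : nat) :
    set ('rV[R]_n -> R) :=
  \bigcup_(l in [set l : nat | (1 <= l)%N]) network phi n l.

Definition uniform_closure {R : realType} {T : choiceType} (S : set (T -> R)) :
    set (T -> R) :=
  closure (S : set {uniform T -> R}).

(* A linear subspace closed under pointwise products; it need not contain
   the constant function 1. *)
Definition function_algebra {R : realType} {T : Type} (A : set (T -> R)) :
    Prop :=
  [/\ A (fun=> 0),
      forall f g, A f -> A g -> A (fun x => f x + g x),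
      forall (c : R) f, A f -> A (fun x => c * f x) &
      forall f g, A f -> A g -> A (fun x => f x * g x)].

(* Main.v *)
(* If [phi] is not constant, then, being bounded, it has a nonzero second
   difference phi (t + 2h) - 2 phi (t + h) + phi t. Let Om be the same second
   difference of a twice iterated primitive of [phi]. Then Om is a locally uniform
   limit of combinations of translates of [phi] (Riemann sums), and its second
   derivative does not vanish at [t], so that second difference quotients of Om
   at [t] approximate s |-> s ^ 2, locally uniformly, by combinations of functions
   s |-> phi (a * s + b). Elements of level l are bounded, so their squares are
   in the closure of level l + 1; by polarization so are the elements
   themselves and their products. *)
Require Import Defs.
From mathcomp Require Import all_boot all_order all_algebra.
From mathcomp Require Import all_classical all_reals all_analysis.
From mathcomp Require Import ring lra.
Import Order.TTheory GRing.Theory Num.Theory.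
Import numFieldNormedType.Exports.
Local Open Scope classical_set_scope.
Local Open Scope ring_scope.

(** * Uniform approximation and one-variable calculus *)

Lemma uniform_closureP {R : realType} {T : choiceType} (S : set (T -> R))
    (f : T -> R) :
  uniform_closure S f <->
  forall e : R, 0 < e -> exists2 g, S g & forall x, `|f x - g x| < e.
Proof.
split=> [cf e e0|Sf B].
  have [|g [Sg fg]] := cf [set g : T -> R | forall x, `|f x - g x| < e].
    apply/uniform_nbhs; exists [set xy | ball xy.1 e xy.2]; split.
      exact: entourage_ball (PosNum e0).
    by move=> g fg x; exact: fg.
  by exists g.
move=> /uniform_nbhs[E [entE EB]].
move: entE; rewrite -entourage_ballE => -[/= e e0 eE].
have [g Sg fg] := Sf e e0.
by exists g; split => //; apply: EB => x _; apply: eE; exact: fg.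
Qed.

(** Compactness of the segment from [- M] to [M]. Only [x] is confined to it, so that no bound on
    [y] has to be checked. *)
Lemma continuous_locally_unif {R : realType} (F : R -> R) :
  continuous F -> forall M e : R, 0 < e -> exists2 d, 0 < d &
    forall x y, `|x| <= M -> `|y - x| < d -> `|F y - F x| < e.
Proof.
move=> cF M e e0.
have e20 : 0 < e / 2 by lra.
have /compact_near_coveringP/near_covering_withinP K := @segment_compact R (- M) M.
have := K R (0^'+) (fun d x => forall y, `|y - x| < d -> `|F y - F x| < e) _.
case.
  move=> x _.
  have /cvgrPdist_lt/(_ _ e20)/nbhs_ballP[d /= d0 Hd] := cF x.
  have d20 : 0 < d / 2 by lra.
  exists (ball x (d/2), [set u | u < d / 2]); first split => /=.
  - exact: nbhsx_ballx.
  - exact: nbhs_right_lt.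
  - move=> [z u] /= [] xz ud _ y yz.
    have Hz : `|F x - F z| < e / 2.
      by apply: Hd; apply: (lt_trans xz); lra.
    have Hy : `|F x - F y| < e / 2.
      apply: Hd; rewrite /ball/= (_ : x - y = (x - z) - (y - z)); last ring.
      by apply: (le_lt_trans (ler_normB _ _)); move: xz; rewrite /ball /=; lra.
    rewrite (_ : F y - F z = (F x - F z) - (F x - F y)); last ring.
    by apply: (le_lt_trans (ler_normB _ _)); lra.
(* The property holds for every radius strictly between 0 and [d]; [d / 2] is one of them. *)
move=> d /= d0 Hd; exists (d / 2); first by rewrite divr_gt0.
move=> x y xM yx; apply: (Hd (d/2) _ _ x) => //=.
- by rewrite sub0r normrN gtr0_norm //; lra.
- by lra.
- by rewrite in_itv /= -ler_norml.
Qed.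

Lemma is_derive_continuous {R : realType} {P F : R -> R} :
  (forall x : R, is_derive x 1 P (F x)) -> continuous P.
Proof.
move=> PF x; apply/differentiable_continuous/derivable1_diffP.
by have [] := PF x.
Qed.

(** No order between [x] and [y] is assumed: the increments behind the square take either sign. *)
Lemma MVT_norm {R : realType} (P F : R -> R) :
  (forall x : R, is_derive x 1 P (F x)) -> forall x y : R,
  exists2 z, `|z - x| <= `|y - x| & P y - P x = (y - x) * F z.
Proof.
move=> PF x y.
have cP (a b : R) : {within `[a, b], continuous P}.
  exact/continuous_subspaceT/(is_derive_continuous PF).
have [xy|/ltW yx] := leP x y.
  have [z + Pz] := MVT_segment xy (fun z _ => PF z) (cP _ _).
  rewrite in_itv /= => /andP[xz zy]; exists z; last by rewrite Pz mulrC.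
  by rewrite !ger0_norm ?subr_ge0//; lra.
have [z + Pz] := MVT_segment yx (fun z _ => PF z) (cP _ _).
rewrite in_itv /= => /andP[yz zx]; exists z; last by rewrite -opprB Pz; ring.
by rewrite !ler0_norm ?subr_le0//; lra.
Qed.

(** Far out on either side [phi] stays within 1 of a limit; compactness handles the segment in
    between. *)
Lemma cvg_pinftyNy_bounded {R : realType} (phi : R -> R) :
  continuous phi -> cvg (phi x @[x --> -oo%R]) -> cvg (phi x @[x --> +oo%R]) ->
  exists C, forall x, `|phi x| <= C.
Proof.
move=> cphi /cvg_ex[/= l1 /cvgrPdist_lt/(_ _ ltr01)[A1 [_ H1]]].
move=> /cvg_ex[/= l2 /cvgrPdist_lt/(_ _ ltr01)[A2 [_ H2]]].
have [C [_ HC]] : bounded_set (phi @` `[A1, A2]).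
  apply/compact_bounded/continuous_compact; last exact: segment_compact.
  exact: continuous_subspaceT.
exists (`|C| + `|l1| + `|l2| + 1) => x.
have ? := normr_ge0 l1; have ? := normr_ge0 l2; have ? := ler_norm C.
have [xA1|A1x] := ltP x A1.
  have := H1 _ xA1; have := ler_normB l1 (l1 - phi x).
  by rewrite opprB addrCA subrr addr0; have := normr_ge0 C; lra.
have [xA2|A2x] := ltP A2 x.
  have := H2 _ xA2; have := ler_normB l2 (l2 - phi x).
  by rewrite opprB addrCA subrr addr0; have := normr_ge0 C; lra.
apply: (le_trans (HC (`|C| + 1) _ (phi x) _)); first lra.
  by exists x => //=; rewrite in_itv /= A1x.
lra.
Qed.

(* Vanishing on the left half-line makes [g] integrable up to any [u]. *)
Lemma primitive_of_zero_on_left {R : realType} (g : R -> R) :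
  continuous g -> (forall x, x <= 0 -> g x = 0) ->
  exists P : R -> R, forall x : R, is_derive x 1 P (g x).
Proof.
move=> cg g0.
pose mu := @lebesgue_measure R.
exists (fun x => \int[mu]_(t in [set` Interval -oo%O (BRight x)]) g t)%R => x.
have ig : mu.-integrable [set` Interval -oo%O (BRight (x + 1))] (EFin \o g).
  have : mu.-integrable `[- `|x|, x + 1] (EFin \o g).
    apply: continuous_compact_integrable; first exact: segment_compact.
    exact: continuous_subspaceT.
  (* Extended by zero, the two restrictions coincide, because [g] vanishes to the left of [-|x|]. *)
  rewrite integrable_mkcond//= [X in _ -> X]integrable_mkcond//=.
  congr (integrable _ _ _); apply/funext => t; rewrite /patch !mem_setE !in_itv/=.
  have [xt//|tx] := leP (- `|x|) t; case: ifP => //= _.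
  by rewrite g0 //; have := normr_ge0 x; lra.
have xx1 : x < x + 1 by lra.
have [dP <-] := continuous_FTC1 xx1 ig (ltNyr _) (cg x).
by rewrite derive1E; apply: DeriveDef.
Qed.

(** [f x] is the sum of [f 0], [f (max x 0) - f 0] and [f (min x 0) - f 0]. The second term vanishes
    on the left half-line, the third does so after the reflection [x] to [- x]. *)
Lemma primitive_exists {R : realType} (f : R -> R) : continuous f ->
  exists P : R -> R, forall x : R, is_derive x 1 P (f x).
Proof.
move=> cf.
(* [(x + |x|) / 2] is [max x 0] and [- (- x + |- x|) / 2] is [min x 0]. *)
have half_line (s : R) : exists P : R -> R, forall x : R,
    is_derive x 1 P (f (s * (x + `|x|) / 2) - f 0).
  apply: primitive_of_zero_on_left => x.
    apply: cvgB; last exact: cvg_cst.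
    apply: (@continuous_comp _ _ _ (fun x : R => s * (x + `|x|) / 2) f); last exact: cf.
    apply: cvgMl; apply: cvgMr; apply: cvgD => //; exact: norm_continuous.
  by move=> x0; rewrite ler0_norm// subrr mulr0 mul0r subrr.
have [P1 P1D] := half_line 1.
have [P2 P2D] := half_line (-1).
exists (fun x => f 0 * x + P1 x - P2 (- x)) => x.
have D2 : is_derive x 1 (P2 \o -%R) (- (f (-1 * (- x + `|- x|) / 2) - f 0)).
  rewrite -[X in is_derive _ _ _ X]mulrN1.
  exact: (@is_derive1_comp _ _ _ _ _ _ (P2D _) (is_deriveNid _ _)).
have D3 : is_derive x 1 (fun x => f 0 * x) (f 0).
  by apply: is_derive_eq; rewrite [_ *: _]mulr1.
apply: (@is_derive_eq _ _ _ _ _ _ _ (f 0 + (f (1 * (x + `|x|) / 2) - f 0) -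
   - (f (-1 * (- x + `|- x|) / 2) - f 0))).
rewrite opprK normrN mul1r mulN1r.
have half_double (y : R) : (y + y) / 2 = y by lra.
have [x0|x0] := ger0P x.
  by rewrite half_double addNr oppr0 mul0r subrr addr0 addrC subrK.
by rewrite subrr mul0r subrr addr0 addrC subrK opprD opprK half_double.
Qed.

(** * Linear subspaces of functions and their uniform closures *)

Definition linear_subspace {R : realType} {T : Type} (S : set (T -> R)) :=
  [/\ S (fun=> 0),
      forall f g, S f -> S g -> S (fun x => f x + g x) &
      forall (c : R) f, S f -> S (fun x => c * f x)].

Lemma linear_subspace_sum {R : realType} {T : Type} {S : set (T -> R)} :
  linear_subspace S -> forall m (f : 'I_m -> T -> R),
  (forall i, S (f i)) -> S (fun x => \sum_(i < m) f i x).
Proof.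
move=> [S0 SD SZ]; elim=> [|m IH] f Sf.
  by rewrite (_ : (fun x => _) = fun=> 0)//; apply/funext => x; rewrite big_ord0.
rewrite (_ : (fun x => _) = fun x =>
  \sum_(i < m) f (widen_ord (leqnSn m) i) x + f ord_max x); last first.
  by apply/funext => x; rewrite big_ord_recr.
by apply: SD => //; exact: IH.
Qed.

Lemma fun_span_subspace {R : realType} {T : Type} (S : set (T -> R)) :
  linear_subspace (fun_span S).
Proof.
split.
- exists 0%N, (fun=> 0), (fun=> fun=> 0); split; first by case.
  by apply/funext => x; rewrite big_ord0.
- move=> _ _ [m [c [g [Sg ->]]]] [p [c' [g' [Sg' ->]]]].
  exists (m + p)%N,
    (fun i => match fintype.split i with inl j => c j | inr j => c' j end),
    (fun i => match fintype.split i with inl j => g j | inr j => g' j end); split.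
    by move=> i; case: fintype.split.
  apply/funext => x; rewrite big_split_ord /=; congr (_ + _); apply: eq_bigr => i _.
    by rewrite (unsplitK (inl i)).
  by rewrite (unsplitK (inr i)).
- move=> a _ [m [c [g [Sg ->]]]].
  exists m, (fun i => a * c i), g; split=> //.
  by apply/funext => x; rewrite mulr_sumr; apply: eq_bigr => i _; rewrite mulrA.
Qed.

Lemma sub_fun_span {R : realType} {T : Type} (S : set (T -> R)) :
  S `<=` fun_span S.
Proof.
move=> f Sf; exists 1%N, (fun=> 1), (fun=> f); split=> //.
by apply/funext => x; rewrite big_ord1 mul1r.
Qed.

Section uniform_closure_theory.
Context {R : realType} {T : choiceType}.
Implicit Types (S U : set (T -> R)) (f g : T -> R).

Lemma sub_uniform_closure S : S `<=` uniform_closure S.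
Proof.
move=> f Sf; apply/uniform_closureP => e e0; exists f => // x.
by rewrite subrr normr0.
Qed.

Lemma uniform_closure_lim S f :
  (forall e : R, 0 < e ->
    exists2 g, uniform_closure S g & forall x, `|f x - g x| < e) ->
  uniform_closure S f.
Proof.
move=> Sf; apply/uniform_closureP => e e0.
have e20 : 0 < e / 2 by lra.
have [g /uniform_closureP/(_ _ e20)[h Sh gh] fg] := Sf _ e20.
exists h => // x; have := ler_distD (g x) (f x) (h x).
by have := gh x; have := fg x; lra.
Qed.

Lemma uniform_closure_sub S U :
  S `<=` uniform_closure U -> uniform_closure S `<=` uniform_closure U.
Proof.
move=> SU f Sf; apply: uniform_closure_lim => e e0.
by move/uniform_closureP/(_ _ e0) : Sf => [g /SU]; exists g.
Qed.

(** Sums need only land in the closure of [U]: for nonconstant [phi], the sum of two networks of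
    different levels is only shown to be a limit of networks. *)
Lemma uniform_closureD S U :
  (forall f g, S f -> S g -> uniform_closure U (fun x => f x + g x)) ->
  forall f g, uniform_closure S f -> uniform_closure S g ->
    uniform_closure U (fun x => f x + g x).
Proof.
move=> SU f g /uniform_closureP Sf /uniform_closureP Sg.
apply: uniform_closure_lim => e e0.
have e20 : 0 < e / 2 by lra.
have [f' Sf' ff'] := Sf _ e20; have [g' Sg' gg'] := Sg _ e20.
exists (fun x => f' x + g' x); first exact: SU.
move=> x; rewrite opprD addrACA; apply: (le_lt_trans (ler_normD _ _)).
by have := ff' x; have := gg' x; lra.
Qed.

Lemma uniform_closureZ S U :
  (forall c f, S f -> uniform_closure U (fun x => c * f x)) ->
  forall c f, uniform_closure S f -> uniform_closure U (fun x => c * f x).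
Proof.
move=> SU c f /uniform_closureP Sf.
apply: uniform_closure_lim => e e0.
have c0 := normr_ge0 c.
(* The added 1 covers [c = 0]. *)
have [|f' Sf' ff'] := Sf (e / (`|c| + 1)); first by apply: divr_gt0 => //; lra.
exists (fun x => c * f' x); first exact: SU.
move=> x; rewrite -mulrBr normrM.
have := ff' x; rewrite ltr_pdivlMr; last lra.
by have := normr_ge0 (f x - f' x); nra.
Qed.

Lemma uniform_closureM S U :
  (forall f, S f -> exists C, forall x, `|f x| <= C) ->
  (forall f g, S f -> S g -> uniform_closure U (fun x => f x * g x)) ->
  forall f g, uniform_closure S f -> uniform_closure S g ->
    uniform_closure U (fun x => f x * g x).
Proof.
move=> bS SU f g /uniform_closureP Sf /uniform_closureP Sg.
(* [f1] serves only to bound [f], which fixes the tolerance for [g']; the tolerance for [f'] then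
   depends on the bound of [g']. *)
have [f1 /bS[C fC] ff1] := Sf _ ltr01.
have fC1 x : `|f x| < `|C| + 1.
  have := ler_normD (f x - f1 x) (f1 x); rewrite subrK.
  by have := ff1 x; have := fC x; have := ler_norm C; lra.
apply: uniform_closure_lim => e e0.
have C0 := normr_ge0 C.
have [|g' Sg' gg'] := Sg (e / 2 / (`|C| + 1)).
  by apply: divr_gt0; lra.
have [D gD] := bS _ Sg'.
have D0 := normr_ge0 D.
have [|f' Sf' ff'] := Sf (e / 2 / (`|D| + 1)).
  by apply: divr_gt0; lra.
exists (fun x => f' x * g' x); first exact: SU.
move=> x.
rewrite (_ : _ - _ = f x * (g x - g' x) + (f x - f' x) * g' x); last ring.
apply: (le_lt_trans (ler_normD _ _)); rewrite !normrM.
have := gg' x; have := ff' x.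
rewrite !ltr_pdivlMr; try lra.
have := fC1 x; have := gD x; have := ler_norm D.
have := normr_ge0 (f x - f' x); have := normr_ge0 (g x - g' x).
nra.
Qed.

Lemma uniform_closure_subspace S :
  linear_subspace S -> linear_subspace (uniform_closure S).
Proof.
move=> [S0 SD SZ]; split; first exact: sub_uniform_closure.
- by apply: uniform_closureD => f g Sf Sg; apply/sub_uniform_closure/SD.
- by apply: uniform_closureZ => c f Sf; apply/sub_uniform_closure/SZ.
Qed.

End uniform_closure_theory.

(** If all second differences vanish, [phi] is affine along every arithmetic progression;
    boundedness forces slope zero there, so any two values agree. *)
Lemma second_difference_neq0 {R : realType} (phi : R -> R) (C : R) :
  (forall x, `|phi x| <= C) -> (exists x y, phi x != phi y) ->
  exists t h, 0 < h /\ phi (t + h + h) - phi (t + h) - (phi (t + h) - phi t) != 0.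
Proof.
move=> phiC [x [y phixy]]; apply: contrapT => noD.
have D0 t h : 0 < h ->
    phi (t + h + h) - phi (t + h) = phi (t + h) - phi t.
  move=> h0; apply/eqP; rewrite -subr_eq0; apply: contrapT => /negP Dn0.
  by apply: noD; exists t, h.
have arith t h k : 0 < h -> phi (t + h *+ k) = phi t + (phi (t + h) - phi t) *+ k.
  (* The induction also carries the constancy of successive increments. *)
  move=> h0; suff: phi (t + h *+ k) = phi t + (phi (t + h) - phi t) *+ k /\
      phi (t + h *+ k.+1) - phi (t + h *+ k) = phi (t + h) - phi t by case.
  elim: k => [|k [IH1 IH2]]; first by rewrite !mulr0n !addr0.
  split; first by rewrite [in RHS]mulrSr addrA -IH1 -IH2 addrC subrK.
  by rewrite !mulrSr !addrA D0 // -addrA -mulrSr.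
have step t h : 0 < h -> phi (t + h) = phi t.
  move=> h0; apply/eqP; rewrite -subr_eq0; apply: contrapT => /negP d0.
  have d0' : 0 < `|phi (t + h) - phi t| by rewrite normr_gt0.
  have C0 : 0 <= C by rewrite (le_trans _ (phiC t)).
  have [k kC] : exists k : nat, (C + C) / `|phi (t + h) - phi t| < k%:R.
    eexists; apply: archi_boundP; rewrite divr_ge0 ?normr_ge0//; lra.
  move: kC; rewrite ltr_pdivrMr// -[k%:R]ger0_norm// -normrM mulr_natl.
  rewrite (_ : _ *+ k = phi (t + h *+ k) - phi t); last first.
    by rewrite arith// [RHS]addrAC subrr add0r.
  have := ler_normB (phi (t + h *+ k)) (phi t).
  by have := phiC t; have := phiC (t + h *+ k); lra.
move: phixy; have [xy|yx|->] := ltgtP x y; last by rewrite eqxx.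
- by rewrite -(step x (y - x)) ?subr_gt0// addrC subrK eqxx.
- by rewrite -(step y (x - y)) ?subr_gt0// [y + _]addrC subrK eqxx.
Qed.

Lemma is_derive_increment {R : realType} {P F : R -> R} :
  (forall x : R, is_derive x 1 P (F x)) -> forall c x : R,
  is_derive x 1 (fun x => P (x + c) - P x) (F (x + c) - F x).
Proof.
move=> PF c x; apply: is_deriveB.
rewrite -[X in is_derive _ _ _ X]mulr1.
exact: (@is_derive1_comp _ P (shift c) _ _ _ (PF _) (is_derive_shift _ _ _)).
Qed.

(** With the shift [b] built in, [phi] operates from each positive level to the next by the
    recursive clause of [network]. *)
Definition operates {R : realType} {T : Type} (V W : set (T -> R)) (F : R -> R) :=
  forall h b, V h -> W (fun x => F (h x + b)).

(** * Operating functions: from the activation to the square *)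

Section operates_theory.
Context {R : realType} {T : choiceType}.
Variables V W : set (T -> R).
Hypothesis V_bounded : forall h, V h -> exists C, forall x, `|h x| <= C.
Hypothesis V_scale : forall (c : R) h, V h -> V (fun x => c * h x).
Hypothesis W_subspace : linear_subspace W.
Notation acts := (operates V (uniform_closure W)).

(** [V] absorbs the factor [a] and the shift absorbs the rest; [a = 0] yields the constant [F b]. *)
Lemma operates_affine F a b : acts F -> acts (fun t => F (a * t + b)).
Proof.
move=> aF h c Vh; have := aF _ (a * c + b) (V_scale a _ Vh).
rewrite (_ : (fun x => F _) = fun x => F (a * (h x + c) + b))//.
by apply/funext => x; rewrite mulrDr addrA.
Qed.

Lemma operatesD F G : acts F -> acts G -> acts (fun t => F t + G t).
Proof.
have [_ WD _] := uniform_closure_subspace _ W_subspace.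
by move=> aF aG h b Vh; apply: WD; [exact: aF|exact: aG].
Qed.

Lemma operatesZ c F : acts F -> acts (fun t => c * F t).
Proof.
have [_ _ WZ] := uniform_closure_subspace _ W_subspace.
by move=> aF h b Vh; apply: WZ; exact: aF.
Qed.

Lemma operatesB F G : acts F -> acts G -> acts (fun t => F t - G t).
Proof.
move=> aF aG; have := operatesD _ _ aF (operatesZ (-1) _ aG).
by congr acts; apply/funext => t; rewrite mulN1r.
Qed.

Lemma operates_sum m (F : 'I_m -> R -> R) :
  (forall i, acts (F i)) -> acts (fun t => \sum_(i < m) F i t).
Proof.
move=> aF h b Vh.
apply: (linear_subspace_sum (uniform_closure_subspace _ W_subspace)
  _ (fun i x => F i (h x + b))).
by move=> i; exact: aF.
Qed.

(** Elements of [V] are bounded, so [h x + b] stays in a segment and locally uniform approximation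
    of [F] suffices. *)
Lemma operates_lim F :
  (forall M e : R, 0 < e -> exists2 G, acts G &
    forall t, `|t| <= M -> `|F t - G t| < e) -> acts F.
Proof.
move=> limF h b Vh; apply: uniform_closure_lim => e e0.
have [C hC] := V_bounded _ Vh.
have [G aG FG] := limF (C + `|b|) e e0.
exists (fun x => G (h x + b)); first exact: aG.
by move=> x; apply: FG; rewrite (le_trans (ler_normD _ _))// lerD2r.
Qed.

(* The increment of a primitive is a locally uniform limit of Riemann sums. *)
Lemma operates_increment (P F : R -> R) (h : R) : 0 < h ->
  continuous F -> (forall x : R, is_derive x 1 P (F x)) ->
  acts F -> acts (fun t => P (t + h) - P t).
Proof.
move=> h0 cF PF aF; apply: operates_lim => M e e0.
(* Each of the [N.+1] terms will err by at most [s * (e / 2 / h)], hence the sum by at most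
   [e / 2]. *)
have e'0 : 0 < e / 2 / h by apply: divr_gt0 => //; lra.
have [d d0 Fd] := continuous_locally_unif _ cF (M + h) _ e'0.
have [N hN] : exists N : nat, h / N.+1%:R < d.
  exists (Num.Def.archi_bound (h / d)).
  rewrite ltr_pdivrMr ?ltr0n// mulrC -ltr_pdivrMr//.
  apply: (lt_le_trans (archi_boundP _)); first by rewrite divr_ge0// ltW.
  by rewrite ler_nat.
set s := h / N.+1%:R in hN.
have s0 : 0 < s by rewrite divr_gt0 ?ltr0n.
have sN : s * N.+1%:R = h by rewrite /s divfK// pnatr_eq0.
exists (fun t => \sum_(k < N.+1) s * F (1 * t + k%:R * s)).
  by apply: operates_sum => k; apply/operatesZ/operates_affine.
move=> t tM.
(* Telescoping over the nodes; by the mean value theorem each increment is [s * F z] with [z] within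
   [s < d] of the left node. *)
have -> : P (t + h) - P t =
    \sum_(k < N.+1) (P (t + k.+1%:R * s) - P (t + k%:R * s)).
  rewrite -(big_mkord xpredT (fun k => P (t + k.+1%:R * s) - P (t + k%:R * s))).
  rewrite telescope_sumr //= => //.
  by rewrite mul0r addr0 [_ * s]mulrC sN.
rewrite -sumrB; apply: (le_lt_trans (ler_norm_sum _ _ _)).
apply: (@le_lt_trans _ _ (\sum_(k < N.+1) s * (e / 2 / h))); last first.
  rewrite sumr_const card_ord -mulrnAl -[s *+ _]mulr_natr sN [h * _]mulrC divfK ?gt_eqF//.
  lra.
apply: ler_sum => k _.
have kN : k%:R * s <= h.
  by rewrite -sN mulrC ler_pM2l// ler_nat ltnW.
have ks0 : 0 <= k%:R * s by rewrite mulr_ge0// ltW.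
have [z zx ->] := MVT_norm _ _ PF (t + k%:R * s) (t + k.+1%:R * s).
have step : t + k.+1%:R * s - (t + k%:R * s) = s by rewrite -natr1; ring.
rewrite step in zx *; rewrite mul1r -mulrBr normrM gtr0_norm// ler_pM2l//.
apply/ltW/Fd.
  by rewrite (le_trans (ler_normD _ _))// (ger0_norm ks0); lra.
by rewrite (le_lt_trans zx)// gtr0_norm.
Qed.

(* Second difference quotients of [Om] at [t0] in the direction [t] tend to
   [p t0 * t ^ 2], where [p] is the second derivative of [Om]. *)
Lemma operates_sqr (Om q p : R -> R) (t0 : R) :
  (forall x : R, is_derive x 1 Om (q x)) -> (forall x : R, is_derive x 1 q (p x)) ->
  continuous p -> p t0 != 0 -> acts Om -> acts (fun t => t ^+ 2).
Proof.
move=> Omq qp cp pt0 aOm; apply: operates_lim => M e e0.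
have np0 : 0 < `|p t0| by rewrite normr_gt0.
have M0 : 0 <= M ^+ 2 by rewrite sqr_ge0.
have e'0 : 0 < e * `|p t0| / (M ^+ 2 + 1) by rewrite divr_gt0 ?mulr_gt0//; lra.
have [d d0 pd] := continuous_locally_unif _ cp `|t0| _ e'0.
have nM0 := normr_ge0 M.
(* Chosen so that [2 * |s * t| < d] whenever [|t| <= M]. *)
pose s := d / (2 * (`|M| + 1)).
have s0 : 0 < s by rewrite divr_gt0//; lra.
(* The constant [Om t0] is written with [0 * t] to fall under [operates_affine]. *)
exists (fun t => (s ^+ 2 * p t0)^-1 *
    (Om (s * t + t0) - Om (0 * t + t0) - (Om (0 * t + t0) - Om (- s * t + t0)))).
  by apply: operatesZ; apply: operatesB; apply: operatesB; apply: operates_affine.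
move=> t tM; rewrite !mul0r !add0r mulNr.
have std : `|s * t| + `|s * t| < d.
  rewrite normrM gtr0_norm//.
  have : s * (2 * (`|M| + 1)) = d by rewrite divfK//; lra.
  by have := ler_norm M; nra.
(* The mean value theorem is applied to an increment of [Om] between [t0] and [t0 - s * t], then to
   [q]; thus [y] lies within [2 * |s * t|] of [t0]. *)
have [z zt0 Dz] := MVT_norm _ _ (is_derive_increment Omq (s * t)) t0 (- (s * t) + t0).
have [y yz Dy] := MVT_norm _ _ qp z (z + s * t).
rewrite addrAC subrr add0r in yz.
rewrite addrK normrN in zt0.
rewrite Dy (_ : - (s * t) + t0 + s * t = t0) in Dz; last by ring.
rewrite addrK (_ : z + s * t - z = s * t) in Dz; last by ring.
have -> : Om (s * t + t0) - Om t0 - (Om t0 - Om (- (s * t) + t0)) = (s * t) ^+ 2 * p y.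
  rewrite -opprB [s * t + _]addrC Dz; ring.
have yt0 : `|p y - p t0| < e * `|p t0| / (M ^+ 2 + 1).
  apply: pd => //; rewrite (le_lt_trans (ler_distD z _ _))//.
  by move: std; lra.
have -> : t ^+ 2 - (s ^+ 2 * p t0)^-1 * ((s * t) ^+ 2 * p y) =
    - (t ^+ 2 * ((p y - p t0) / p t0)).
  by field; rewrite pt0 gt_eqF.
rewrite normrN normrM ger0_norm ?sqr_ge0// normf_div.
have t2 : t ^+ 2 <= M ^+ 2.
  by rewrite -(real_normK (num_real t)) lerXn2r ?nnegrE// (le_trans _ tM).
rewrite mulrA ltr_pdivrMr//.
move: yt0; rewrite ltr_pdivlMr; last lra.
have := normr_ge0 (p y - p t0).
nra.
Qed.

(** Polarization: [4 t] is the difference of the squares of [t + 1] and [t - 1]. *)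
Lemma operates_id : acts (fun t => t ^+ 2) -> acts id.
Proof.
move=> a2; have := operatesZ (4^-1) _
  (operatesB _ _ (operates_affine _ 1 1 a2) (operates_affine _ 1 (-1) a2)).
by congr acts; apply/funext => t; field.
Qed.

Lemma operates_sqr_of_nonconstant (phi : R -> R) (C : R) :
  continuous phi -> (forall x, `|phi x| <= C) -> (exists x y, phi x != phi y) ->
  acts phi -> acts (fun t => t ^+ 2).
Proof.
move=> cphi phiC nphi aphi.
have [t [h [h0 D]]] := second_difference_neq0 _ _ phiC nphi.
have [P PD] := primitive_exists _ cphi.
have QD := is_derive_increment PD h.
have cQ := is_derive_continuous QD.
(* Primitive and increment alternate, since only the increment of [P], not [P] itself, is shown to
   operate. The increment of [Q'] plays the part of [Om]; its second derivative is the second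
   difference of [phi]. *)
have [Q' Q'D] := primitive_exists _ cQ.
apply: (operates_sqr _ _ _ t (is_derive_increment Q'D h)
  (is_derive_increment QD h) _ D).
  have shift_cont : continuous (fun x : R => x + h).
    by move=> x; apply: cvgD; [exact: cvg_id|exact: cvg_cst].
  have cphih : continuous (fun x => phi (x + h)).
    by move=> x; apply: (@continuous_comp _ _ _ (fun x : R => x + h) phi);
      [exact: shift_cont|exact: cphi].
  have cphihh : continuous (fun x => phi (x + h + h)).
    by move=> x; apply: (@continuous_comp _ _ _ (fun x : R => x + h)
      (fun x => phi (x + h))); [exact: shift_cont|exact: cphih].
  by move=> x; apply: cvgB; apply: cvgB;
    [exact: cphihh|exact: cphih|exact: cphih|exact: cphi].
apply: (operates_increment _ _ _ h0 cQ Q'D).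
exact: (operates_increment _ _ _ h0 cphi PD aphi).
Qed.

End operates_theory.

(** * Elementary properties of networks *)

Lemma network_bounded {R : realType} (phi : R -> R) (n l : nat) (C : R) f :
  (forall x, `|phi x| <= C) -> network phi n l.+1 f ->
  exists D, forall x, `|f x| <= D.
Proof.
move=> phiC [m [c [g [Sg ->]]]].
exists (\sum_(i < m) `|c i| * C) => x.
apply: (le_trans (ler_norm_sum _ _ _)); apply: ler_sum => i _.
by rewrite normrM; have [h [b [_ ->]]] := Sg i; apply: ler_wpM2l.
Qed.

Lemma network_constant {R : realType} (phi : R -> R) (n l : nat) f :
  (forall x y, phi x = phi y) -> network phi n l.+1 f -> forall x y, f x = f y.
Proof.
move=> cphi [m [c [g [Sg ->]]]] x y; apply: eq_bigr => i _; congr (_ * _).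
by have [h [b [_ ->]]] := Sg i; exact: cphi.
Qed.

Lemma network_subspace {R : realType} (phi : R -> R) (n l : nat) :
  linear_subspace (network phi n l.+1).
Proof. exact: fun_span_subspace. Qed.

Lemma network_inftyZ {R : realType} (phi : R -> R) (n : nat) (c : R) f :
  network_infty phi n f -> network_infty phi n (fun x => c * f x).
Proof.
case=> -[//|l] l0 Nf; exists l.+1 => //.
by have [_ _ NZ] := network_subspace phi n l; exact: NZ.
Qed.

(** * Constant activation: every network is a constant function *)

Section constant_activation.
Context {R : realType} (phi : R -> R) (n : nat).
Hypothesis phi_constant : forall x y, phi x = phi y.
Notation N := (network_infty phi n).

Let N_constant f : N f -> exists c, f = fun=> c.
Proof.
case=> -[//|l] _ Nf; exists (f 0); apply/funext => x.
exact: network_constant phi_constant Nf x 0.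
Qed.

(** If [f] is a nonzero constant, [f + g] is a multiple of it and stays at the level of [f]; no
    comparison of levels is needed. *)
Lemma constant_networkD f g : N f -> N g -> N (fun x => f x + g x).
Proof.
move=> Nf Ng; have [a fa] := N_constant _ Nf; have [b gb] := N_constant _ Ng.
have [a0|a0] := eqVneq a 0.
  by rewrite fa a0 (_ : (fun x => _) = g)//; apply/funext => x; rewrite add0r.
rewrite (_ : (fun x => _) = fun x => (1 + b / a) * f x); first exact: network_inftyZ.
by apply/funext => x; rewrite fa gb mulrDl mul1r divfK.
Qed.

Lemma constant_networkM f g : N f -> N g -> N (fun x => f x * g x).
Proof.
move=> Nf /N_constant[b ->].
by under eq_fun do rewrite mulrC; exact: network_inftyZ.
Qed.

End constant_activation.

(** * Nonconstant activation: raising levels and polarizing *)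

Section nonconstant_activation.
Context {R : realType} (phi : R -> R) (n : nat) (C : R).
Hypothesis phi_cont : continuous phi.
Hypothesis phi_bounded : forall x, `|phi x| <= C.
Hypothesis phi_nonconstant : exists x y, phi x != phi y.
Notation N := (network phi n).

Let square_operates l :
  operates (N l.+1) (uniform_closure (N l.+2)) (fun t => t ^+ 2).
Proof.
apply: (operates_sqr_of_nonconstant _ _ _ _ _ phi C) => //.
- by move=> h; exact: network_bounded phi_bounded.
- by have [_ _ NZ] := network_subspace phi n l; exact: NZ.
- exact: network_subspace.
- move=> h b Nh; apply/sub_uniform_closure/sub_fun_span.
  by exists h, b.
Qed.

(** The identity operates because the square does, so the levels are nested up to closure. *)
Let network_sub_closure l : N l.+1 `<=` uniform_closure (N l.+2).
Proof.
have idN : operates (N l.+1) (uniform_closure (N l.+2)) id.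
  apply: operates_id (square_operates l); last exact: network_subspace.
  by have [_ _ NZ] := network_subspace phi n l; exact: NZ.
move=> f Nf; have := idN f 0 Nf.
by rewrite (_ : (fun x => _) = f)//; apply/funext => x; rewrite addr0.
Qed.

Let closure_network_mono l k :
  uniform_closure (N l.+1) `<=` uniform_closure (N (l + k).+1).
Proof.
elim: k => [|k IH]; first by rewrite addn0.
apply: (subset_trans IH); rewrite addnS.
exact/uniform_closure_sub/network_sub_closure.
Qed.

Let closure_network_infty l :
  uniform_closure (N l.+1) `<=` uniform_closure (network_infty phi n).
Proof.
by apply: uniform_closure_sub => f Nf; apply: sub_uniform_closure; exists l.+1.
Qed.

(** Passing to closures raises both networks to one level, where they can be added and
    multiplied. *)
Let common_level f g : network_infty phi n f -> network_infty phi n g ->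
  exists l, uniform_closure (N l.+1) f /\ uniform_closure (N l.+1) g.
Proof.
move=> [[//|l] _ Nf] [[//|k] _ Ng]; exists (l + k)%N; split.
  exact/closure_network_mono/sub_uniform_closure.
by rewrite addnC; exact/closure_network_mono/sub_uniform_closure.
Qed.

Lemma nonconstant_networkD f g :
  network_infty phi n f -> network_infty phi n g ->
  uniform_closure (network_infty phi n) (fun x => f x + g x).
Proof.
move=> Nf Ng; have [l [fl gl]] := common_level _ _ Nf Ng.
apply: (closure_network_infty l).
have [_ WD _] := uniform_closure_subspace _ (network_subspace phi n l).
exact: WD.
Qed.

Lemma nonconstant_networkM f g :
  network_infty phi n f -> network_infty phi n g ->
  uniform_closure (network_infty phi n) (fun x => f x * g x).
Proof.
move=> Nf Ng; have [l [fl gl]] := common_level _ _ Nf Ng.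
(* Squaring costs one level: products from level [l.+1] are approximated at level [l.+2]. *)
apply: (closure_network_infty l.+1).
apply: (uniform_closureM _ _ _ _ f g fl gl).
  by move=> h; exact: network_bounded phi_bounded.
move=> {fl gl Nf Ng}f {}g Nf Ng.
have [_ ND NZ] := network_subspace phi n l.
have [_ WD WZ] := uniform_closure_subspace _ (network_subspace phi n l.+1).
have sqrN h : N l.+1 h -> uniform_closure (N l.+2) (fun x => h x ^+ 2).
  move=> Nh; have := square_operates l h 0 Nh.
  by under eq_fun do rewrite addr0.
(* Polarization: [f * g] is a quarter of the difference of the squares of [f + g] and [f - g]. *)
have := WD _ _ (WZ 4^-1 _ (sqrN _ (ND _ _ Nf Ng)))
  (WZ (- 4^-1) _ (sqrN _ (ND _ _ Nf (NZ (-1) _ Ng)))).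
by congr (uniform_closure _ _); apply/funext => x; field.
Qed.

End nonconstant_activation.

Theorem corollary2p3 (R : realType) (n : nat) (n_gt0 : (0 < n)%N)
    (phi : R -> R) (phi_cont : continuous phi)
    (phi_cvgNy : cvg (phi x @[x --> -oo%R]))
    (phi_cvgy : cvg (phi x @[x --> +oo%R])) :
  function_algebra (uniform_closure (network_infty phi n)).
Proof.
have [C phiC] := cvg_pinftyNy_bounded _ phi_cont phi_cvgNy phi_cvgy.
(* Sums and products of networks themselves are enough; approximation extends both to the
   closure. *)
have [ND NM] : (forall f g, network_infty phi n f -> network_infty phi n g ->
    uniform_closure (network_infty phi n) (fun x => f x + g x)) /\
  (forall f g, network_infty phi n f -> network_infty phi n g ->
    uniform_closure (network_infty phi n) (fun x => f x * g x)).
  (* A constant [phi] has only zero second differences and is treated separately. *)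
  have [nc|c] := pselect (exists x y, phi x != phi y).
    split; first exact: nonconstant_networkD nc.
    exact: nonconstant_networkM nc.
  have phi_cst x y : phi x = phi y.
    by apply: contrapT => /eqP xy; apply: c; exists x, y.
  split=> f g Nf Ng; apply: sub_uniform_closure.
    exact: constant_networkD.
  exact: constant_networkM.
split.
- apply: sub_uniform_closure; exists 1%N => //.
  by have [] := network_subspace phi n 0.
- exact: uniform_closureD.
- by apply: uniform_closureZ => c f Nf; exact/sub_uniform_closure/network_inftyZ.
- apply: uniform_closureM => // f [[//|l] _].
  exact: network_bounded phiC.
Qed.
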